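(* Let $\mathcal{A}$ be a $*$-algebra and $H$ a Hilbert $\mathcal{A}$-$\mathcal{A}$ bimodule with nondegenerate right action. Suppose that $\delta:\mathcal{A}\to H$ is a derivation. Then there exist a positive sesquilinear form $\langle\cdot,\cdot\rangle$ and a $*$-bimodule structure on $\mathcal{A}\otimes\mathcal{A}$, an isometric bimodule homomorphism $\phi:\mathcal{A}\otimes\mathcal{A}\to H$, which extends to $\overline{\mathcal{A}\otimes\mathcal{A}/\langle\cdot,\cdot\rangle}$, and a derivation $\partial:\mathcal{A}\to\overline{\mathcal{A}\otimes\mathcal{A}/\langle\cdot,\cdot\rangle}$ such that $\delta=\phi\circ\partial$ and $\mathcal{A}\delta(\mathcal{A})\mathcal{A}\subset\phi(\mathcal{A}\otimes\mathcal{A})$. The bimodule structure on $\mathcal{A}\otimes\mathcal{A}$ is given by $$A(B\otimes C)D=AB\otimes CD-A\otimes BCD$$ for all $A,B,C,D\in\mathcal{A}$. If $\mathcal{A}$ is unital, then $\partial$ maps via $\mathcal{A}\otimes\mathcal{A}$ and is given by $$\partial(A)=[A\otimes 1]\in\mathcal{A}\otimes\mathcal{A}/\langle\cdot,\cdot\rangle,$$ where $[\cdot]$ denotes the equivalence class in the quotient.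
   Context: Sesquilinear forms are linear in the first and antilinear in the second coordinate; algebras are over $\mathbb{C}$ and $\otimes$ is the algebraic tensor product. Bimodules: an $\mathcal{A}$-$\mathcal{A}$ bimodule is a vector space $H$ with algebra homomorphisms $L$ and $R$ from $\mathcal{A}$ and the opposite algebra $\mathcal{A}^\circ$, respectively, to the linear maps on $H$ such that $L(\mathcal{A})$ and $R(\mathcal{A})$ commute (actions are not assumed unital); write $Ax=L(A)x$, $xA=R(A)x$. For a $*$-algebra $\mathcal{A}$, an $\mathcal{A}$-$\mathcal{A}$ $*$-bimodule is such a bimodule with a positive (semidefinite) sesquilinear form such that $\langle Ax,y\rangle=\langle x,A^*y\rangle$, $\langle xA,y\rangle=\langle x,yA^*\rangle$ for all $x,y\in H$, $A\in\mathcal{A}$, and all $L(A)$, $R(A)$ are bounded. If $H$ is a Hilbert space with this form, it is called a Hilbert $\mathcal{A}$-$\mathcal{A}$ bimodule. The right action is nondegenerate if $x\in H$ and $xA=0$ for all $A\in\mathcal{A}$ imply $x=0$. Derivation: a linear map $\delta:\mathcal{A}\to H$ into an $\mathcal{A}$-$\mathcal{A}$ bimodule with $\delta(AB)=A\delta(B)+\delta(A)B$ for all $A,B\in\mathcal{A}$. The displayed bimodule structure on $\mathcal{A}\otimes\mathcal{A}$ means that the left action is $A(B\otimes C)=AB\otimes C-A\otimes BC$ and the right action is $(B\otimes C)D=B\otimes CD$. $\mathcal{A}\otimes\mathcal{A}/\langle\cdot,\cdot\rangle$ denotes the quotient of $\mathcal{A}\otimes\mathcal{A}$ by $\{x:\langle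 x,x\rangle=0\}$ with the induced inner product and bimodule structure, and $\overline{\mathcal{A}\otimes\mathcal{A}/\langle\cdot,\cdot\rangle}$ its completion, with the actions extended by continuity. ''Isometric'' means $\langle\phi(x),\phi(y)\rangle_H=\langle x,y\rangle$ for all $x,y$. In $\delta=\phi\circ\partial$, $\phi$ denotes the extension to the completion. $\mathcal{A}\delta(\mathcal{A})\mathcal{A}$ denotes the set of all elements $A\delta(B)C$ with $A,B,C\in\mathcal{A}$. *)

(* Defs.v *)
From HB Require Import structures.
From mathcomp Require Import all_boot all_order all_algebra.
From mathcomp Require Import sesquilinear generic_quotient ring_quotient.
From mathcomp Require Import finmap monalg complex.
From mathcomp Require Import ring.
From mathcomp Require Import boolp reals classical_sets topology normedtype sequences.

Set Implicit Arguments.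
Unset Strict Implicit.
Unset Printing Implicit Defensive.

Import Order.TTheory GRing.Theory Num.Theory Num.Def.
Import numFieldNormedType.Exports.

Local Open Scope ring_scope.
Local Open Scope quotient_scope.
Local Open Scope classical_set_scope.

Section SubspaceZmod.
Variables (F : nzRingType) (V : lmodType F) (S : submodClosed V).

Lemma submodClosedN : oppr_closed S.
Proof. by move=> x xS; rewrite -scaleN1r rpredZ. Qed.

Definition submod_zmodClosed : zmodClosed V :=
  HB.pack_for (zmodClosed V) (GRing.SubmodClosed.sort S)
    (GRing.isOppClosed.Build V (GRing.SubmodClosed.sort S) submodClosedN).

End SubspaceZmod.

Definition quot_space (F : nzRingType) (V : lmodType F) (S : submodClosed V) :=
  Quotient.quot (submod_zmodClosed S).

HB.instance Definition _ F V S := GRing.Zmodule.on (@quot_space F V S).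

Section QuotSpace.
Variables (F : nzRingType) (V : lmodType F) (S : submodClosed V).
Local Notation Q := (quot_space S).

Definition quot_proj (x : V) : Q := \pi_(Quotient.quot (submod_zmodClosed S)) x.
Definition quot_repr (x : Q) : V := repr (x : Quotient.quot (submod_zmodClosed S)).

Lemma quot_reprK : cancel quot_repr quot_proj.
Proof. exact: reprK. Qed.

Lemma quot_projP (x y : V) : quot_proj x = quot_proj y <-> x - y \in S.
Proof.
rewrite -[x - y \in S]/(x - y \in submod_zmodClosed S) Quotient.idealrBE.
by split=> [|/eqP //]; rewrite /quot_proj => ->.
Qed.

Lemma quot_proj_zmod : zmod_morphism quot_proj.
Proof. exact: pi_is_zmod_morphism. Qed.

Definition quot_scale (c : F) (x : Q) : Q := quot_proj (c *: quot_repr x).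

Lemma quot_scaleE c x : quot_scale c (quot_proj x) = quot_proj (c *: x).
Proof.
apply/quot_projP; rewrite -scalerBr rpredZ //.
by apply/quot_projP; rewrite quot_reprK.
Qed.

HB.instance Definition _ := GRing.isZmodMorphism.Build V Q quot_proj
  quot_proj_zmod.

Lemma quot_scaleA a b x :
  quot_scale a (quot_scale b x) = quot_scale (a * b) x.
Proof. by rewrite -[x]quot_reprK !quot_scaleE scalerA. Qed.

Lemma quot_scale1 : left_id 1 quot_scale.
Proof. by move=> x; rewrite -[x]quot_reprK quot_scaleE scale1r. Qed.

Lemma quot_scaleDr : right_distributive quot_scale +%R.
Proof.
move=> a x y; rewrite -[x]quot_reprK -[y]quot_reprK -raddfD !quot_scaleE.
by rewrite scalerDr raddfD.
Qed.

Lemma quot_scaleDl x : {morph quot_scale^~ x : a b / a + b}.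
Proof.
by move=> a b /=; rewrite -[x]quot_reprK !quot_scaleE scalerDl raddfD.
Qed.

HB.instance Definition _ := GRing.Zmodule_isLmodule.Build F Q
  quot_scaleA quot_scale1 quot_scaleDr quot_scaleDl.

Lemma quot_proj_scalable : scalable quot_proj.
Proof. by move=> a x /=; rewrite -quot_scaleE. Qed.

HB.instance Definition _ := GRing.isScalable.Build F V Q *:%R quot_proj
  quot_proj_scalable.

End QuotSpace.

Section Span.
Variables (F : nzRingType) (V : lmodType F) (X : V -> Prop).

Definition linspan : {pred V} := fun x =>
  `[< exists2 s : seq (F * V),
        forall p, p \in s -> X p.2 & x = \sum_(p <- s) p.1 *: p.2 >].

Lemma linspan_submod : submod_closed linspan.
Proof.
split=> [|a x y]; first by apply/asboolP; exists [::]; rewrite ?big_nil.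
move=> /asboolP[s sX ->] /asboolP[t tX ->]; apply/asboolP.
exists ([seq (a * p.1, p.2) | p <- s] ++ t).
  move=> p; rewrite mem_cat => /orP[/mapP[q qs ->]|]; last exact: tX.
  exact: sX q qs.
rewrite big_cat big_map scaler_sumr; congr (_ + _).
by apply: eq_bigr => p _; rewrite scalerA.
Qed.

HB.instance Definition _ := GRing.isSubmodClosed.Build F V linspan
  (GRing.submod_closed_semi linspan_submod).
End Span.

(* The free module on [U * V] is represented by finitely supported functions;
   [<< (u, v) >>] is the basis vector indexed by [(u, v)]. *)
Section Tensor.
Variables (F : comNzRingType) (U V : lmodType F).

Inductive tensor_rel : {malg F[(U * V)%type]} -> Prop :=
| TensorRelL (c : F) (u u' : U) (v : V) :
    tensor_rel (<< (c *: u + u', v) >> - (c *: << (u, v) >> + << (u', v) >>))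
| TensorRelR (c : F) (u : U) (v v' : V) :
    tensor_rel (<< (u, c *: v + v') >> - (c *: << (u, v) >> + << (u, v') >>)).

Definition tensor := quot_space (linspan tensor_rel).

HB.instance Definition _ := GRing.Lmodule.on tensor.

Definition tens (u : U) (v : V) : tensor :=
  quot_proj (linspan tensor_rel) << (u, v) >>.

Lemma tensor_rel_span x : tensor_rel x -> x \in linspan tensor_rel.
Proof.
move=> rx; apply/asboolP; exists [:: (1, x)]; last by rewrite big_seq1 scale1r.
by move=> p; rewrite inE => /eqP ->.
Qed.

Lemma tens_linearl (v : V) : linear (tens^~ v).
Proof.
move=> c u u'; rewrite -[RHS](linearP (quot_proj (linspan tensor_rel))).
by apply/quot_projP; apply/tensor_rel_span/TensorRelL.
Qed.

Lemma tens_linearr (u : U) : linear (tens u).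
Proof.
move=> c v v'; rewrite -[RHS](linearP (quot_proj (linspan tensor_rel))).
by apply/quot_projP; apply/tensor_rel_span/TensorRelR.
Qed.

HB.instance Definition _ :=
  bilinear_isBilinear.Build F U V tensor _ _ tens
  (tens_linearl, tens_linearr).

End Tensor.

Reserved Notation "{ 'psdform' V }" (format "{ 'psdform'  V }").

HB.mixin Record isPositiveForm (R : realType) (V : lmodType R[i])
    (f : V -> V -> R[i]) := {
  form_ge0 : forall x, 0 <= f x x
}.

HB.structure Definition PositiveForm (R : realType) (V : lmodType R[i]) :=
  {f of @Bilinear R[i] V V R[i] *%R (conjC \; *%R) f
      & @isPositiveForm R V f}.

Notation "{ 'psdform' V }" := (@PositiveForm.type _ V) : type_scope.

Section FormNotions.
Variables (R : realType) (V : lmodType R[i]) (f : {psdform V}).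

Definition form_norm (x : V) : R := Num.sqrt (complex.Re (f x x)).

Definition form_definite := forall x, f x x = 0 -> x = 0.

Definition form_complete := forall u : nat -> V,
  (forall e : R, 0 < e -> exists N : nat, forall m n : nat,
     (N <= m)%N -> (N <= n)%N -> form_norm (u m - u n) < e) ->
  exists l : V, (fun n => form_norm (u n - l)) @ \oo --> (0 : R).

Definition is_hilbert := form_definite /\ form_complete.

Definition form_bounded (T : V -> V) :=
  exists M : R, forall x, form_norm (T x) <= M * form_norm x.

End FormNotions.

Section FormTheory.
Variables (R : realType) (V : lmodType R[i]) (f : {psdform V}).
Implicit Types x y : V.

Lemma form_addl x y z : f (x + y) z = f x z + f y z.
Proof. exact: linearDl. Qed.

Lemma form_addr x y z : f x (y + z) = f x y + f x z.
Proof. exact: linearDr. Qed.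

Lemma form_scalel (c : R[i]) x y : f (c *: x) y = c * f x y.
Proof. exact: linearZl_LR. Qed.

Lemma form_scaler (c : R[i]) x y : f x (c *: y) = conjC c * f x y.
Proof. exact: linearZr_LR. Qed.

Lemma form_hermitian x y : f x y = conjC (f y x).
Proof.
have real_form z : conjC (f z z) = f z z.
  by apply/CrealP; rewrite ger0_real ?form_ge0.
have := real_form (x + y); have := real_form (x + 'i *: y).
rewrite !(form_addl, form_addr, form_scalel, form_scaler) conjCi.
rewrite !(rmorphD, rmorphM, rmorphN) /= conjCi !real_form !opprK.
set z := f x y; set w := f y x => E1 E2.
have {}E2 : z^* + w^* = z + w.
  by move/eqP: E2; rewrite -subr_eq0 => /eqP E2; apply/eqP; rewrite -subr_eq0 -E2;
    apply/eqP; ring.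
have {}E1 : z^* - w^* = w - z.
  apply: (mulfI (neq0Ci R[i])); move/eqP: E1; rewrite -subr_eq0 => /eqP E1.
  by apply/eqP; rewrite -subr_eq0 -E1; apply/eqP; ring.
have two0 : 2 != 0 :> R[i] by rewrite pnatr_eq0.
apply: (mulfI two0); rewrite !mulr_natl !mulr2n.
have -> : w^* + w^* = (z^* + w^*) - (z^* - w^*).
  by ring.
by rewrite E1 E2; ring.
Qed.

Lemma form_null_eq0 x y : f x x = 0 -> f x y = 0.
Proof.
move=> x0; apply/eqP/negPn/negP => xy0; set z := f x y in xy0.
have n0 : 0 < z * conjC z by rewrite -normCK exprn_gt0 ?normr_gt0.
pose s := (f y y + 1) / (z * conjC z).
have sR : conjC s = s.
  apply/CrealP; rewrite rpredM ?rpredV ?ger0_real ?(ltW n0) //.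
  by rewrite addr_ge0 ?form_ge0.
have := form_ge0 (s := f) (y + (- (s * conjC z)) *: x).
rewrite !(form_addl, form_addr, form_scalel, form_scaler) x0 !mulr0 addr0.
rewrite (form_hermitian y x) -/z rmorphN rmorphM /= conjCK sR !mulNr.
have sz : s * (z * conjC z) = f y y + 1 by rewrite divfK ?gt_eqF.
have -> : f y y - s * z * conjC z - s * conjC z * z = - (f y y + 2).
  transitivity (f y y - 2 * (s * (z * conjC z))); first by ring.
  by rewrite sz; ring.
rewrite oppr_ge0 => /(lt_le_trans (ltr_wpDl (form_ge0 y) (ltr0n _ 2))).
by rewrite ltxx.
Qed.

Definition form_null : {pred V} := fun x => f x x == 0.

Lemma form_nullP x : x \in form_null <-> f x x = 0.
Proof. by split=> /eqP. Qed.

Lemma form_null_submod : submod_closed form_null.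
Proof.
split=> [|a x y]; first by apply/form_nullP; exact: linear0l.
move=> /form_nullP x0 /form_nullP y0; apply/form_nullP.
by rewrite form_addl form_scalel (form_null_eq0 _ x0) (form_null_eq0 _ y0) mulr0 addr0.
Qed.

HB.instance Definition _ := GRing.isSubmodClosed.Build R[i] V form_null
  (GRing.submod_closed_semi form_null_submod).

Definition form_quot := quot_space form_null.

HB.instance Definition _ := GRing.Lmodule.on form_quot.

Definition form_quot_proj : {linear V -> form_quot} := quot_proj form_null.

Lemma form_quot_surj u : exists x, u = form_quot_proj x.
Proof. by exists (quot_repr u); rewrite -[LHS]quot_reprK. Qed.

(* The induced inner product; see [quot_formE] for its value on classes. *)
Definition quot_form (u v : form_quot) : R[i] := f (quot_repr u) (quot_repr v).

Lemma quot_repr_null x :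
  let d := quot_repr (form_quot_proj x) - x in f d d = 0.
Proof. by apply/form_nullP/quot_projP; rewrite quot_reprK. Qed.

Lemma quot_formE x y : quot_form (form_quot_proj x) (form_quot_proj y) = f x y.
Proof.
rewrite /quot_form; have := quot_repr_null y; have := quot_repr_null x.
set x' := quot_repr _; set y' := quot_repr _ => /= nx ny.
rewrite -[x'](subrK x) -[y'](subrK y) form_addl (form_null_eq0 _ nx) add0r.
by rewrite form_addr form_hermitian (form_null_eq0 _ ny) conjC0 add0r.
Qed.

Lemma quot_form_linearl w : linear_for *%R (quot_form^~ w).
Proof.
move=> c u v; have [x ->] := form_quot_surj u; have [y ->] := form_quot_surj v.
have [z ->] := form_quot_surj w.
by rewrite -linearP !quot_formE form_addl form_scalel.
Qed.

Lemma quot_form_linearr w : linear_for (conjC \; *%R) (quot_form w).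
Proof.
move=> c u v; have [x ->] := form_quot_surj u; have [y ->] := form_quot_surj v.
have [z ->] := form_quot_surj w.
by rewrite -linearP !quot_formE form_addr form_scaler.
Qed.

HB.instance Definition _ := bilinear_isBilinear.Build R[i] form_quot form_quot
  R[i] _ _ quot_form (quot_form_linearl, quot_form_linearr).

Lemma quot_form_ge0 u : 0 <= quot_form u u.
Proof. exact: form_ge0. Qed.

HB.instance Definition _ := isPositiveForm.Build R form_quot quot_form
  quot_form_ge0.

End FormTheory.

(* No unit is assumed, hence the library's rings are not used. *)
HB.mixin Record Lmodule_isStarAlgebra (R : realType) A
    of GRing.Lmodule R[i] A := {
  amul : A -> A -> A;
  astar : A -> A;
  amul_linearl : forall b, linear (amul^~ b);
  amul_linearr : forall a, linear (amul a);
  amulA : associative amul;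
  astar_antilinear : forall (c : R[i]) (a b : A),
    astar (c *: a + b) = conjC c *: astar a + astar b;
  astarK : involutive astar;
  astarM : forall a b, astar (amul a b) = amul (astar b) (astar a)
}.

#[short(type="starAlgType")]
HB.structure Definition StarAlgebra (R : realType) :=
  {A of GRing.Lmodule R[i] A & Lmodule_isStarAlgebra R A}.


Section Bimodules.
Variables (R : realType) (A : starAlgType R).

(* [lact a x] is the left action a x and [ract a x] is the right action x a. *)
Record bimodule (H : lmodType R[i]) := Bimodule {
  lact : {bilinear A -> H -> H};
  ract : {bilinear A -> H -> H};
  lactM : forall a b x, lact (amul a b) x = lact a (lact b x);
  ractM : forall a b x, ract (amul a b) x = ract b (ract a x);
  lract_comm : forall a b x, lact a (ract b x) = ract b (lact a x)
}.

Record starBimodule (H : lmodType R[i]) := StarBimodule {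
  bimodule_of :> bimodule H;
  ip : {psdform H};
  ip_lact : forall a x y,
    ip (lact bimodule_of a x) y = ip x (lact bimodule_of (astar a) y);
  ip_ract : forall a x y,
    ip (ract bimodule_of a x) y = ip x (ract bimodule_of (astar a) y);
  lact_bounded : forall a, form_bounded ip (lact bimodule_of a);
  ract_bounded : forall a, form_bounded ip (ract bimodule_of a)
}.

Definition is_derivation (H : lmodType R[i]) (B : bimodule H) (d : A -> H) :=
  forall a b, d (amul a b) = lact B a (d b) + ract B b (d a).

Definition is_bimodule_hom (H K : lmodType R[i]) (B : bimodule H)
    (C : bimodule K) (h : H -> K) :=
  forall a x, h (lact B a x) = lact C a (h x) /\ h (ract B a x) = ract C a (h x).

Definition is_isometric (H K : lmodType R[i]) (B : starBimodule H)
    (C : starBimodule K) (h : H -> K) :=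
  forall x y, ip C (h x) (h y) = ip B x y.

Definition ract_nondegenerate (H : lmodType R[i]) (B : bimodule H) :=
  forall x, (forall a, ract B a x = 0) -> x = 0.

Section Quotient.
Variables (V : lmodType R[i]) (B : starBimodule V).
Local Notation Q := (form_quot (ip B)).
Local Notation proj := (form_quot_proj (ip B)).

Lemma lact_null a x : ip B x x = 0 -> ip B (lact B a x) (lact B a x) = 0.
Proof. by move=> x0; rewrite ip_lact (form_null_eq0 _ x0). Qed.

Lemma ract_null a x : ip B x x = 0 -> ip B (ract B a x) (ract B a x) = 0.
Proof. by move=> x0; rewrite ip_ract (form_null_eq0 _ x0). Qed.

(* The induced actions; see [quot_lactE] and [quot_ractE] for their values on
   classes. *)
Definition quot_lact (a : A) (x : Q) : Q := proj (lact B a (quot_repr x)).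
Definition quot_ract (a : A) (x : Q) : Q := proj (ract B a (quot_repr x)).

Lemma quot_lactE a x : quot_lact a (proj x) = proj (lact B a x).
Proof.
apply/quot_projP/form_nullP; rewrite -linearBr.
exact/lact_null/quot_repr_null.
Qed.

Lemma quot_ractE a x : quot_ract a (proj x) = proj (ract B a x).
Proof.
apply/quot_projP/form_nullP; rewrite -linearBr.
exact/ract_null/quot_repr_null.
Qed.

Lemma quot_lact_linearl u : linear (quot_lact^~ u).
Proof.
move=> c a b; have [x ->] := form_quot_surj u.
by rewrite /= !quot_lactE linearPl linearP.
Qed.

Lemma quot_lact_linearr a : linear (quot_lact a).
Proof.
move=> c u v; have [x ->] := form_quot_surj u; have [y ->] := form_quot_surj v.
by rewrite -linearP !quot_lactE linearPr linearP.
Qed.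

Lemma quot_ract_linearl u : linear (quot_ract^~ u).
Proof.
move=> c a b; have [x ->] := form_quot_surj u.
by rewrite /= !quot_ractE linearPl linearP.
Qed.

Lemma quot_ract_linearr a : linear (quot_ract a).
Proof.
move=> c u v; have [x ->] := form_quot_surj u; have [y ->] := form_quot_surj v.
by rewrite -linearP !quot_ractE linearPr linearP.
Qed.

HB.instance Definition _ := bilinear_isBilinear.Build R[i] A Q Q _ _ quot_lact
  (quot_lact_linearl, quot_lact_linearr).

HB.instance Definition _ := bilinear_isBilinear.Build R[i] A Q Q _ _ quot_ract
  (quot_ract_linearl, quot_ract_linearr).

Lemma quot_lactM a b u :
  quot_lact (amul a b) u = quot_lact a (quot_lact b u).
Proof. by have [x ->] := form_quot_surj u; rewrite !quot_lactE lactM. Qed.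

Lemma quot_ractM a b u :
  quot_ract (amul a b) u = quot_ract b (quot_ract a u).
Proof. by have [x ->] := form_quot_surj u; rewrite !quot_ractE ractM. Qed.

Lemma quot_lract_comm a b u :
  quot_lact a (quot_ract b u) = quot_ract b (quot_lact a u).
Proof.
have [x ->] := form_quot_surj u.
by rewrite quot_ractE !quot_lactE quot_ractE lract_comm.
Qed.

Definition quot_bimodule : bimodule Q :=
  @Bimodule Q quot_lact quot_ract quot_lactM quot_ractM quot_lract_comm.

Definition quot_ip : {psdform Q} := quot_form (f := ip B).

Lemma quot_ip_lact a u v :
  quot_ip (lact quot_bimodule a u) v
  = quot_ip u (lact quot_bimodule (astar a) v).
Proof.
have [x ->] := form_quot_surj u; have [y ->] := form_quot_surj v.
by rewrite /= !quot_lactE !quot_formE ip_lact.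
Qed.

Lemma quot_ip_ract a u v :
  quot_ip (ract quot_bimodule a u) v
  = quot_ip u (ract quot_bimodule (astar a) v).
Proof.
have [x ->] := form_quot_surj u; have [y ->] := form_quot_surj v.
by rewrite /= !quot_ractE !quot_formE ip_ract.
Qed.

Lemma quot_lact_bounded a : form_bounded quot_ip (lact quot_bimodule a).
Proof.
have [M bM] := lact_bounded B a; exists M => u.
have [x ->] := form_quot_surj u.
by have := bM x; rewrite /form_norm /= quot_lactE !quot_formE.
Qed.

Lemma quot_ract_bounded a : form_bounded quot_ip (ract quot_bimodule a).
Proof.
have [M bM] := ract_bounded B a; exists M => u.
have [x ->] := form_quot_surj u.
by have := bM x; rewrite /form_norm /= quot_ractE !quot_formE.
Qed.

Definition quot_starBimodule : starBimodule Q :=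
  StarBimodule quot_ip_lact quot_ip_ract quot_lact_bounded quot_ract_bounded.

End Quotient.

(* [K], with [j : V -> K], is the completion of the inner product space [V].
   As the actions on [K] are bounded, [completion_hom] says that they are the
   extensions by continuity of those on [V]. *)
Record is_completion (V K : lmodType R[i]) (B : starBimodule V)
    (C : starBimodule K) (j : {linear V -> K}) : Prop := IsCompletion {
  completion_hilbert : is_hilbert (ip C);
  completion_isometric : is_isometric B C j;
  completion_dense : forall (y : K) (e : R), 0 < e ->
    exists x, form_norm (ip C) (y - j x) < e;
  completion_hom : is_bimodule_hom B C j
}.

End Bimodules.

(* Main.v *)
From HB Require Import structures.
From mathcomp Require Import all_boot all_order all_algebra.
From mathcomp Require Import sesquilinear finmap monalg complex.
From mathcomp Require Import ring lra.
From mathcomp Require Import interval_inference boolp reals classical_sets.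
From mathcomp Require Import topology normedtype.
Require Import Defs.

(** Everything is forced by wanting phi (a (x) b) = delta(a) b. This is bilinear
in a and b, so it defines phi on the tensor product ([deriv_lift]). By the
Leibniz rule c (delta(a) b) = delta(ca) b - delta(c) (ab), which is
phi (ca (x) b - c (x) ab): phi intertwines the displayed actions on the tensor
product with the actions on H ([deriv_lift_hom]), and the elements
a delta(b) c lie in its range ([lact_derivation]). Taking the pullback along phi
of the inner product of H as the form on the tensor product makes phi isometric,
and adjointness and boundedness of the actions are inherited from H
([pull_starBimodule]).

As H is complete, the completion of the quotient of the tensor product can be
realised inside H as the closure K of the range of phi ([range_is_completion]).
The extension of phi is then the inclusion of K in H, and the derivation
into K has to be delta itself, so that the one thing to prove is that delta
takes its values in K, although only the products delta(a) b are in the range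
of phi. This is where completeness and nondegeneracy enter
([mem_closed_of_ract]): let z be the difference of delta(a) and its nearest point
in K. Then z is orthogonal to K and z b is in K for all b, so
<z b, z b> = <z, z b b*> = 0 for all b, and z = 0 by nondegeneracy.

If A has a unit e, then delta(a) e and delta(a) have the same products with all
b, so delta(a) = delta(a) e = phi (a (x) e), again by nondegeneracy. *)

Set Implicit Arguments.
Unset Strict Implicit.
Unset Printing Implicit Defensive.

Import Order.TTheory GRing.Theory Num.Theory.
Import numFieldNormedType.Exports.

Local Open Scope ring_scope.

(** * Linear maps on free modules and tensor products *)

Section FreeModule.
Variables (F : nzRingType) (K : choiceType) (W : lmodType F) (f : K -> W).

Definition malg_lift (g : {malg F[K]}) : W := \sum_(k <- msupp g) g@_k *: f k.

Lemma malg_liftEw (d : {fset K}) (g : {malg F[K]}) : (msupp g `<=` d)%fset ->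
  malg_lift g = \sum_(k <- d) g@_k *: f k.
Proof.
move=> sgd; rewrite /malg_lift (big_fset_incl _ sgd) // => k _ /mcoeff_outdom ->.
exact: scale0r.
Qed.

Lemma malg_lift_linear : linear malg_lift.
Proof.
move=> c g h; pose d := (msupp g `|` msupp h)%fset.
have sgd : (msupp g `<=` d)%fset by exact: fsubsetUl.
have shd : (msupp h `<=` d)%fset by exact: fsubsetUr.
rewrite (malg_liftEw sgd) (malg_liftEw shd) (@malg_liftEw d); last first.
  apply: fsubset_trans (msuppD_le _ _) _; rewrite fsubUset shd andbT.
  exact: fsubset_trans (msuppZ_le _ _) sgd.
rewrite scaler_sumr -big_split /=; apply: eq_bigr => k _.
by rewrite mcoeffD mcoeffZ scalerDl scalerA.
Qed.

HB.instance Definition _ :=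
  GRing.isLinear.Build F {malg F[K]} W *:%R malg_lift malg_lift_linear.

Lemma malg_liftU k : malg_lift << k >> = f k.
Proof. by rewrite (malg_liftEw msuppU_le) big_seq_fset1 mcoeffUU scale1r. Qed.

End FreeModule.

Section TensorLift.
Variables (F : comNzRingType) (U V W : lmodType F) (f : {bilinear U -> V -> W}).

Local Notation lift := (malg_lift (fun p : U * V => f p.1 p.2)).

Definition tensor_lift (t : tensor U V) : W := lift (quot_repr t).

(** The relations divided out in the tensor product hold in [W] because [f] is
bilinear, so [f] descends to the quotient. *)
Lemma malg_lift_rel x : x \in linspan (@tensor_rel F U V) -> lift x = 0.
Proof.
move=> /asboolP[s sX ->]; rewrite linear_sum big_seq big1 // => p /sX.
rewrite linearZ; case: p => c x0 /= rx; suff -> : lift x0 = 0 by exact: scaler0.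
case: rx => [d u u' v|d u v v']; rewrite linearB linearP /= !malg_liftU /=.
  by rewrite linearPl subrr.
by rewrite linearPr subrr.
Qed.

Lemma tensor_lift_proj x :
  tensor_lift (quot_proj (linspan (@tensor_rel F U V)) x) = lift x.
Proof.
apply/eqP; rewrite -subr_eq0 -linearB; apply/eqP/malg_lift_rel.
by apply/quot_projP; rewrite quot_reprK.
Qed.

Lemma tensor_lift_linear : linear tensor_lift.
Proof.
move=> c s t; rewrite -[s]quot_reprK -[t]quot_reprK -linearP.
by rewrite !tensor_lift_proj linearP.
Qed.

HB.instance Definition _ :=
  GRing.isLinear.Build F (tensor U V) W *:%R tensor_lift tensor_lift_linear.

Lemma tensor_liftE u v : tensor_lift (tens u v) = f u v.
Proof. by rewrite tensor_lift_proj malg_liftU. Qed.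

End TensorLift.

(** Combinations [c *: s + t] suffice because the pure tensors span: this is the
form in which linearity of a map is used. *)
Lemma tensor_ind (F : comNzRingType) (U V : lmodType F)
    (P : tensor U V -> Prop) :
  (forall c s t, P s -> P t -> P (c *: s + t)) -> P 0 ->
  (forall u v, P (tens u v)) -> forall t, P t.
Proof.
move=> Plin P0 Ptens t; rewrite -[t]quot_reprK [quot_repr t]monalgE linear_sum.
apply: (big_ind P) => // [s r Ps Pr|[u v] _]; first by rewrite -[s]scale1r; exact: Plin.
rewrite (_ : << _ *g _ >> = (quot_repr t)@_(u, v) *: << (u, v) >>); last first.
  by apply/malgP => k; rewrite mcoeffZ !mcoeffU mulr_natr.
by rewrite linearZ /= -[_ *: _]addr0; exact: Plin (Ptens u v) P0.
Qed.

Lemma tensor_linear_ext (F : comNzRingType) (U V W : lmodType F)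
    (f g : {linear tensor U V -> W}) :
  (forall u v, f (tens u v) = g (tens u v)) -> f =1 g.
Proof.
move=> fg; apply: tensor_ind => [c s t fs ft||//]; last by rewrite !linear0.
by rewrite !linearP fs ft.
Qed.
Local Open Scope classical_set_scope.

(** * The seminorm of a positive form *)

Section FormNorm.
Variables (R : realType) (V : lmodType R[i]) (f : {psdform V}).
Local Notation N := (form_norm f).
Local Notation reip x y := (complex.Re (f x y)).

Lemma form_real x : f x x = (reip x x)%:C%C.
Proof.
by have := form_ge0 (s := f) x; rewrite lecE; case: (f x x) => a b /= /andP[/eqP-> _].
Qed.

Lemma reip_ge0 x : 0 <= reip x x.
Proof. by rewrite -lecR -form_real form_ge0. Qed.

Lemma form_norm_ge0 x : 0 <= N x.
Proof. exact: sqrtr_ge0. Qed.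

Lemma form_normE x : N x ^+ 2 = reip x x.
Proof. by rewrite sqr_sqrtr // reip_ge0. Qed.

Lemma form_norm0 : N 0 = 0.
Proof. by rewrite /form_norm linear0l sqrtr0. Qed.

Lemma form_norm_eq0 x : N x = 0 -> f x x = 0.
Proof. by move=> x0; rewrite form_real -form_normE x0 expr0n. Qed.

Lemma reipC x y : reip x y = reip y x.
Proof. by rewrite form_hermitian; case: (f y x). Qed.

Lemma form_norm_sqrD x y :
  N (x + y) ^+ 2 = N x ^+ 2 + 2 * reip x y + N y ^+ 2.
Proof.
rewrite !form_normE !(form_addl, form_addr) !raddfD /= (reipC y x).
by rewrite -addrA -addrA mulr_natl mulr2n -!addrA.
Qed.

Lemma form_normZ (c : R[i]) x : N (c *: x) = complex.Re `|c| * N x.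
Proof.
have c0 : 0 <= complex.Re `|c| by rewrite -lecR RRe_real ?normr_real ?normr_ge0.
apply/eqP; rewrite -(@eqrXn2 _ 2) ?mulr_ge0 ?form_norm_ge0 //; apply/eqP.
rewrite exprMn !form_normE form_scalel form_scaler mulrA -normCK form_real.
have {1}-> : `|c| = (complex.Re `|c|)%:C%C by rewrite RRe_real ?normr_real.
by rewrite -rmorphXn -rmorphM.
Qed.

Lemma form_normZr (t : R) x : N (t%:C%C *: x) = `|t| * N x.
Proof. by rewrite form_normZ normc_def /= expr0n addr0 sqrtr_sqr. Qed.

Lemma form_normN x : N (- x) = N x.
Proof. by rewrite -scaleN1r form_normZ normrN1 mul1r. Qed.

Lemma form_norm_distC x y : N (x - y) = N (y - x).
Proof. by rewrite -form_normN opprB. Qed.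

Lemma reipZr (t : R) x y : reip x (t%:C%C *: y) = t * reip x y.
Proof.
by rewrite form_scaler; case: (f x y) => a b /=; rewrite oppr0 mul0r subr0.
Qed.

Lemma reip_le x y : reip x y <= N x * N y.
Proof.
(* the square of the norm of x + t y, a nonnegative polynomial in t *)
have pos t : 0 <= N x ^+ 2 + 2 * (t * reip x y) + t ^+ 2 * N y ^+ 2.
  by rewrite -reipZr -[t ^+ 2](real_normK (num_real t)) -exprMn -form_normZr -form_norm_sqrD sqr_ge0.
have Nx0 := form_norm_ge0 x; have Ny0 := form_norm_ge0 y.
move: (reip x y) (N x) (N y) pos Nx0 Ny0 => r a b pos a0 b0.
(* When b is positive the polynomial is minimal at t = - r / b^2; when b = 0 it is
   affine in t and becomes negative for some t unless r = 0. *)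
have [rle|r0] := leP r 0; first exact: le_trans rle (mulr_ge0 a0 b0).
have [b00|bn0] := eqVneq b 0.
  have := pos (- (a ^+ 2 + 1) / (2 * r)); rewrite b00 expr0n /= mulr0 addr0.
  have -> : 2 * (- (a ^+ 2 + 1) / (2 * r) * r) = - (a ^+ 2 + 1).
    by field; exact: lt0r_neq0.
  lra.
have {bn0}bp : 0 < b by rewrite lt_def bn0.
have := pos (- r / b ^+ 2).
have -> : a ^+ 2 + 2 * (- r / b ^+ 2 * r) + (- r / b ^+ 2) ^+ 2 * b ^+ 2
          = a ^+ 2 - (r / b) ^+ 2 by field; exact: lt0r_neq0.
rewrite subr_ge0 ler_sqr ?nnegrE ?divr_ge0 ?(ltW r0) //.
by rewrite ler_pdivrMr.
Qed.

Lemma ler_form_normD x y : N (x + y) <= N x + N y.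
Proof.
rewrite -ler_sqr ?nnegrE ?addr_ge0 ?form_norm_ge0 // form_norm_sqrD sqrrD.
by rewrite lerD2r lerD2l -[leRHS]mulr_natl ler_wpM2l ?ler0n ?reip_le.
Qed.

Lemma ler_form_distD z x y : N (x - y) <= N (x - z) + N (z - y).
Proof. by rewrite -[x - y](subrKA z) ler_form_normD. Qed.

Lemma form_parallelogram x y :
  N (x + y) ^+ 2 + N (x - y) ^+ 2 = 2 * (N x ^+ 2 + N y ^+ 2).
Proof.
rewrite !form_norm_sqrD form_normN.
have -> : reip x (- y) = - reip x y by rewrite linearNr raddfN.
ring.
Qed.

(** * Closure and nearest points for a positive form *)

(** The closure is spelled out with the seminorm because the module [V] carries
no topology of its own. *)
Definition form_closure (M : {pred V}) : {pred V} := fun x =>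
  `[< forall e : R, 0 < e -> exists2 m, m \in M & N (x - m) < e >].

Definition form_closed (M : {pred V}) :=
  forall x, x \in form_closure M -> x \in M.

Lemma sub_form_closure (M : {pred V}) : {subset M <= form_closure M}.
Proof.
by move=> x xM; apply/asboolP => e e0; exists x; rewrite // subrr form_norm0.
Qed.

Lemma form_closure_closed (M : {pred V}) : form_closed (form_closure M).
Proof.
move=> x /asboolP clx; apply/asboolP => e e0.
have e20 : 0 < e / 2 by rewrite divr_gt0.
have [m /asboolP/(_ _ e20)[m' mM' mm'] xm] := clx _ e20.
exists m' => //; apply: le_lt_trans (ler_form_distD m _ _) _.
by rewrite [e]splitr ltrD.
Qed.

Lemma form_closure_stable (M : {pred V}) (T : {linear V -> V}) :
  form_bounded f T -> {homo T : m / m \in M} ->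
  {homo T : m / m \in form_closure M}.
Proof.
move=> [B TB] TM x /asboolP clx; apply/asboolP => e e0.
(* [B] may be nonpositive, so it is replaced by a positive bound *)
have B0 : 0 < `|B| + 1 by rewrite ltr_wpDl.
have [m mM xm] := clx (e / (`|B| + 1)) (divr_gt0 e0 B0).
exists (T m); first exact: TM.
rewrite -linearB; apply: le_lt_trans (TB _) _.
apply: (@le_lt_trans _ _ ((`|B| + 1) * N (x - m))).
  rewrite ler_wpM2r ?form_norm_ge0 //.
  by rewrite (le_trans (ler_norm B)) // lerDl.
by rewrite mulrC -ltr_pdivlMr.
Qed.

Lemma form_closureD (M : {pred V}) x y :
  {in M &, forall m n, m + n \in M} ->
  x \in form_closure M -> y \in form_closure M -> x + y \in form_closure M.
Proof.
move=> MD /asboolP clx /asboolP cly; apply/asboolP => e e0.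
have e20 : 0 < e / 2 by rewrite divr_gt0.
have [m mM xm] := clx _ e20; have [n nM yn] := cly _ e20.
exists (m + n); first exact: MD.
rewrite opprD addrACA; apply: le_lt_trans (ler_form_normD _ _) _.
by rewrite [e]splitr ltrD.
Qed.

Lemma scale_bounded (c : R[i]) : form_bounded f ( *:%R c).
Proof. by exists (complex.Re `|c|) => x; rewrite form_normZ. Qed.

Section ClosureSubmod.
Variable S : submodClosed V.

Lemma form_closure_submod : submod_closed (form_closure S).
Proof.
split=> [|c x y xS yS]; first by apply/sub_form_closure/rpred0.
apply: form_closureD => //; first exact: rpredD.
apply: (form_closure_stable (T := GRing.scale c)) xS; first exact: scale_bounded.
by move=> m mS; apply: rpredZ.
Qed.

HB.instance Definition _ := GRing.isSubmodClosed.Build R[i] V (form_closure S)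
  (GRing.submod_closed_semi form_closure_submod).
End ClosureSubmod.

Lemma form_cvgP (u : nat -> V) l :
  (fun n => N (u n - l)) @ \oo --> (0 : R) <->
  forall e : R, 0 < e -> exists n0, forall n, (n0 <= n)%N -> N (u n - l) < e.
Proof.
split=> [/cvgr0Pnorm_lt cvu e e0|cvu].
  have [n0 _ un0] := cvu e e0; exists n0 => n /un0 /=.
  by rewrite ger0_norm ?form_norm_ge0.
apply/cvgr0Pnorm_lt => e /cvu[n0 un0]; exists n0 => // n /un0 /=.
by rewrite ger0_norm ?form_norm_ge0.
Qed.

Lemma form_closed_lim (M : {pred V}) (u : nat -> V) l : form_closed M ->
  (forall n, u n \in M) -> (fun n => N (u n - l)) @ \oo --> (0 : R) -> l \in M.
Proof.
move=> Mcl uM /form_cvgP cvu; apply: Mcl; apply/asboolP => e /cvu[n0 un0].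
by exists (u n0); rewrite // form_norm_distC un0.
Qed.

(** A minimising sequence [u] is Cauchy: the midpoint of two of its terms lies in
[S], hence is not closer to [x] than the infimum, and the parallelogram law then
makes the two terms close to each other. *)
Lemma form_nearest_point (S : submodClosed V) : form_complete f ->
  form_closed S -> forall x, exists2 p, p \in S &
    forall k, k \in S -> N (x - p) <= N (x - k).
Proof.
move=> complete Scl x.
pose D := [set N (x - k) ^+ 2 | k in [set k | k \in S]].
have D_inf : has_inf D.
  split; first by exists (N (x - 0) ^+ 2), 0; rewrite //= rpred0.
  by exists 0 => _ [k _ <-]; rewrite sqr_ge0.
have inf_le k : k \in S -> inf D <= N (x - k) ^+ 2.
  by move=> kS; apply: ge_inf; [case: D_inf | exists k].
have /choice[u uP] (n : nat) :
    exists k, k \in S /\ N (x - k) ^+ 2 < inf D + n.+1%:R^-1.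
  have [_ [k kS <-] klt] := @inf_adherent _ D n.+1%:R^-1 ltac:(by rewrite invr_gt0) D_inf.
  by exists k.
(* the parallelogram law for x - u n and x - u m *)
have cauchy_le m n : N (u m - u n) ^+ 2 <= 2 * (m.+1%:R^-1 + n.+1%:R^-1).
  have [umS um] := uP m; have [unS un] := uP n.
  have := form_parallelogram (x - u n) (x - u m).
  have -> : x - u n - (x - u m) = u m - u n by rewrite opprB addrC addrA subrK.
  have -> : N (x - u n + (x - u m)) = 2 * N (x - (2^-1)%:C%C *: (u m + u n)).
    rewrite -[X in X * N _](ger0_norm (ler0n R 2)) -form_normZr; congr N.
    rewrite scalerBr scalerA -rmorphM /= mulfV ?pnatr_eq0 // scale1r.
    rewrite rmorph_nat scaler_nat mulr2n opprD addrACA.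
    by rewrite [- u n + _]addrC.
  have := inf_le ((2^-1)%:C%C *: (u m + u n)) ltac:(by rewrite rpredZ ?rpredD).
  rewrite exprMn; move: um un; move: (inf D) (m.+1%:R^-1) (n.+1%:R^-1).
  move: (N (x - u m) ^+ 2) (N (x - u n) ^+ 2) (N (u m - u n) ^+ 2) (N _ ^+ 2).
  move=> a b w y d r s. lra.
have small (e : R) : 0 < e -> exists n0, forall n, (n0 <= n)%N -> n.+1%:R^-1 < e.
  move=> e0; have [n0 _ /= n0P] := near_infty_natSinv_lt (PosNum e0).
  by exists n0.
have [|p up] := complete u.
  move=> e e0; have e40 : 0 < e ^+ 2 / 4 by rewrite divr_gt0 ?exprn_gt0.
  have [n0 n0P] := small _ e40; exists n0 => m n /n0P mlt /n0P nlt.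
  rewrite -ltr_sqr ?nnegrE ?form_norm_ge0 ?(ltW e0) //.
  apply: le_lt_trans (cauchy_le m n) _.
  by move: (m.+1%:R^-1) (n.+1%:R^-1) mlt nlt => a b; lra.
exists p; first by apply: form_closed_lim up => // n; case: (uP n).
move=> k kS; apply/ler_addgt0Pr => e e0.
have e20 : 0 < e / 2 by rewrite divr_gt0.
have e240 : 0 < (e / 2) ^+ 2 by rewrite exprn_gt0.
have [n1 un1] := (form_cvgP _ _).1 up _ e20; have [n2 n2P] := small _ e240.
pose n := maxn n1 n2; have := un1 n (leq_maxl _ _).
have := n2P n (leq_maxr _ _); have [_ uk] := uP n => small_n near_n.
apply: le_trans (ler_form_distD (u n) _ _) _.
rewrite [e in leRHS]splitr addrA; apply: lerD (ltW near_n).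
rewrite -ler_sqr ?nnegrE ?addr_ge0 ?form_norm_ge0 ?(ltW e20) //.
apply: ltW; apply: lt_le_trans uk _.
apply: le_trans (lerD (inf_le k kS) (ltW small_n)) _.
by rewrite sqrrD lerD2r lerDl mulrn_wge0 // mulr_ge0 ?form_norm_ge0 ?ltW.
Qed.

(** The first variation of the distance vanishes at the nearest point. Moving in
real directions only determines the real part of the inner product, which is
enough here as the products it is applied to are real. *)
Lemma nearest_point_orthogonal (S : submodClosed V) x p :
  p \in S -> (forall k, k \in S -> N (x - p) <= N (x - k)) ->
  forall k, k \in S -> reip (x - p) k = 0.
Proof.
move=> pS pmin k kS.
have pos (t : R) : 0 <= 2 * (t * reip (x - p) k) + t ^+ 2 * N k ^+ 2.
  have := pmin (p + (- t)%:C%C *: k) ltac:(by rewrite rpredD ?rpredZ).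
  rewrite opprD addrA -scaleNr -rmorphN opprK -ler_sqr ?nnegrE ?form_norm_ge0 //.
  rewrite [in leRHS]form_norm_sqrD reipZr form_normZr exprMn real_normK ?num_real //.
  by rewrite -addrA lerDl.
move: (reip _ _) (N k ^+ 2) (sqr_ge0 (N k)) pos => r b b0 pos.
apply/eqP; rewrite -sqrf_eq0; apply/eqP/le_anti; rewrite sqr_ge0 andbT.
(* The best step - r / b would need b != 0; replacing b by b + 1 still makes the
   quadratic term too small to compensate the linear one. *)
have := pos (- r / (b + 1)).
have b1 : 0 < b + 1 by rewrite ltr_wpDl.
have -> : 2 * (- r / (b + 1) * r) + (- r / (b + 1)) ^+ 2 * b
   = - (r ^+ 2 * ((b + 2) / (b + 1) ^+ 2)) by field; exact: lt0r_neq0.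
rewrite oppr_ge0 pmulr_lle0 // divr_gt0 ?exprn_gt0 //; lra.
Qed.

End FormNorm.

(** * Star-bimodules pulled back along a bimodule homomorphism *)

Section PullForm.
Variables (R : realType) (U V : lmodType R[i]) (g : {linear U -> V}).
Variable f : {psdform V}.

Definition pull_form (x y : U) : R[i] := f (g x) (g y).

Lemma pull_form_linearl y : linear_for *%R (pull_form^~ y).
Proof. by move=> c x x'; rewrite /pull_form linearP form_addl form_scalel. Qed.

Lemma pull_form_linearr x : linear_for (Num.conj \; *%R) (pull_form x).
Proof. by move=> c y y'; rewrite /pull_form linearP form_addr form_scaler. Qed.

HB.instance Definition _ := bilinear_isBilinear.Build R[i] U U R[i] _ _
  pull_form (pull_form_linearl, pull_form_linearr).

Lemma pull_form_ge0 x : 0 <= pull_form x x.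
Proof. exact: form_ge0. Qed.

HB.instance Definition _ := isPositiveForm.Build R U pull_form pull_form_ge0.

End PullForm.

Section PullStarBimodule.
Variables (R : realType) (A : starAlgType R) (U V : lmodType R[i]).
Variables (B : bimodule A U) (C : starBimodule A V) (g : {linear U -> V}).
Hypothesis g_hom : is_bimodule_hom B C g.

Lemma pull_ip_lact a x y :
  pull_form g (ip C) (lact B a x) y = pull_form g (ip C) x (lact B (astar a) y).
Proof. by rewrite /pull_form !(g_hom _ _).1 ip_lact. Qed.

Lemma pull_ip_ract a x y :
  pull_form g (ip C) (ract B a x) y = pull_form g (ip C) x (ract B (astar a) y).
Proof. by rewrite /pull_form !(g_hom _ _).2 ip_ract. Qed.

Lemma pull_lact_bounded a : form_bounded (pull_form g (ip C)) (lact B a).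
Proof.
have [M bM] := lact_bounded C a; exists M => x.
by have := bM (g x); rewrite -(g_hom _ _).1.
Qed.

Lemma pull_ract_bounded a : form_bounded (pull_form g (ip C)) (ract B a).
Proof.
have [M bM] := ract_bounded C a; exists M => x.
by have := bM (g x); rewrite -(g_hom _ _).2.
Qed.

Definition pull_starBimodule : starBimodule A U :=
  StarBimodule pull_ip_lact pull_ip_ract pull_lact_bounded pull_ract_bounded.

End PullStarBimodule.

(** * Invariant subspaces of a bimodule *)

Section Subspace.
Variables (F : nzRingType) (V : lmodType F) (S : submodClosed V).

Record subspace := Subspace { subspace_val :> V; _ : subspace_val \in S }.

HB.instance Definition _ := [isSub for subspace_val].
HB.instance Definition _ := [Choice of subspace by <:].
HB.instance Definition _ := [SubChoice_isSubLmodule of subspace by <:].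

Definition subspace_incl : {linear subspace -> V} := val.

Lemma subspace_incl_mem x : subspace_incl x \in S.
Proof. exact: valP. Qed.

Lemma subspace_incl_inj : injective subspace_incl.
Proof. exact: val_inj. Qed.

Section Corestrict.
Variables (U : lmodType F) (g : {linear U -> V}) (gS : forall x, g x \in S).

Definition corestrict x := Subspace (gS x).

Lemma corestrict_linear : linear corestrict.
Proof.
move=> c x y; apply: subspace_incl_inj.
by rewrite linearP; exact: (linearP g).
Qed.

HB.instance Definition _ :=
  GRing.isLinear.Build F U subspace *:%R corestrict corestrict_linear.
End Corestrict.

End Subspace.

Section SubBimodule.
Variables (R : realType) (A : starAlgType R) (H : lmodType R[i]).
Variables (C : bimodule A H) (S : submodClosed H).
Hypothesis lS : forall a, {homo lact C a : x / x \in S}.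
Hypothesis rS : forall a, {homo ract C a : x / x \in S}.
Local Notation incl := (subspace_incl S).

Definition sub_lact a (x : subspace S) : subspace S :=
  Subspace (lS a (subspace_incl_mem x)).
Definition sub_ract a (x : subspace S) : subspace S :=
  Subspace (rS a (subspace_incl_mem x)).

Lemma sub_lactE a x : incl (sub_lact a x) = lact C a (incl x). Proof. by []. Qed.
Lemma sub_ractE a x : incl (sub_ract a x) = ract C a (incl x). Proof. by []. Qed.

Lemma sub_lact_linearl x : linear (sub_lact^~ x).
Proof.
move=> c a b; apply: subspace_incl_inj.
by rewrite linearP !sub_lactE linearPl.
Qed.

Lemma sub_lact_linearr a : linear (sub_lact a).
Proof.
move=> c x y; apply: subspace_incl_inj.
by rewrite linearP !sub_lactE linearP.
Qed.

Lemma sub_ract_linearl x : linear (sub_ract^~ x).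
Proof.
move=> c a b; apply: subspace_incl_inj.
by rewrite linearP !sub_ractE linearPl.
Qed.

Lemma sub_ract_linearr a : linear (sub_ract a).
Proof.
move=> c x y; apply: subspace_incl_inj.
by rewrite linearP !sub_ractE linearP.
Qed.

HB.instance Definition _ := bilinear_isBilinear.Build R[i] A (subspace S)
  (subspace S) _ _ sub_lact (sub_lact_linearl, sub_lact_linearr).
HB.instance Definition _ := bilinear_isBilinear.Build R[i] A (subspace S)
  (subspace S) _ _ sub_ract (sub_ract_linearl, sub_ract_linearr).

Lemma sub_lactM a b x : sub_lact (amul a b) x = sub_lact a (sub_lact b x).
Proof. by apply: subspace_incl_inj; rewrite !sub_lactE lactM. Qed.

Lemma sub_ractM a b x : sub_ract (amul a b) x = sub_ract b (sub_ract a x).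
Proof. by apply: subspace_incl_inj; rewrite !sub_ractE ractM. Qed.

Lemma sub_lract_comm a b x :
  sub_lact a (sub_ract b x) = sub_ract b (sub_lact a x).
Proof.
by apply: subspace_incl_inj; rewrite !(sub_lactE, sub_ractE) lract_comm.
Qed.

Definition sub_bimodule : bimodule A (subspace S) :=
  @Bimodule _ _ _ sub_lact sub_ract sub_lactM sub_ractM sub_lract_comm.

Lemma subspace_incl_hom : is_bimodule_hom sub_bimodule C incl.
Proof. by []. Qed.

End SubBimodule.

(** A Cauchy sequence in the subspace has its limit in the whole space, and
closedness puts the limit back into the subspace. *)
Lemma subspace_hilbert (R : realType) (V : lmodType R[i]) (f : {psdform V})
    (S : submodClosed V) : form_closed f S -> is_hilbert f ->
  is_hilbert (pull_form (subspace_incl S) f).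
Proof.
move=> Scl [def complete]; split=> [x /def x0|u cu].
  by apply: subspace_incl_inj; rewrite x0 linear0.
have [|l ul] := complete (fun n => subspace_incl S (u n)).
  move=> e /cu[n0 un0]; exists n0 => m n mn nn.
  by rewrite -linearB; exact: un0.
have lS : l \in S.
  by apply: form_closed_lim ul => // n; exact: subspace_incl_mem.
by exists (Subspace lS).
Qed.

(** * Completion as the closure of a range *)

Section LinearRange.
Variables (F : nzRingType) (U V : lmodType F) (g : {linear U -> V}).

Definition linear_range : {pred V} := fun y => `[< exists x, y = g x >].

Lemma mem_linear_range x : g x \in linear_range.
Proof. by apply/asboolP; exists x. Qed.

Lemma linear_range_submod : submod_closed linear_range.
Proof.
split=> [|c _ _ /asboolP[x ->] /asboolP[y ->]].
  by rewrite -[0](linear0 g) mem_linear_range.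
by rewrite -linearP mem_linear_range.
Qed.

HB.instance Definition _ := GRing.isSubmodClosed.Build F V linear_range
  (GRing.submod_closed_semi linear_range_submod).
End LinearRange.

Section RangeCompletion.
Variables (R : realType) (A : starAlgType R) (V H : lmodType R[i]).
Variables (B : starBimodule A V) (C : starBimodule A H) (g : {linear V -> H}).
Hypotheses (g_iso : is_isometric B C g) (g_hom : is_bimodule_hom B C g).
Hypothesis hilbertH : is_hilbert (ip C).

(** An isometric homomorphism into a complete bimodule provides the completion of
its source: the closure of its range. *)
Definition range_closure : submodClosed H := form_closure (ip C) (linear_range g).

Local Notation Q := (form_quot (ip B)).
Local Notation proj := (form_quot_proj (ip B)).
Local Notation K := (subspace range_closure).
Local Notation incl := (subspace_incl range_closure).

Lemma mem_range_closure x : g x \in range_closure.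
Proof. exact/sub_form_closure/mem_linear_range. Qed.

Lemma range_closure_lact a : {homo lact C a : x / x \in range_closure}.
Proof.
apply: form_closure_stable; first exact: lact_bounded.
by move=> _ /asboolP[x ->]; apply/asboolP; exists (lact B a x); rewrite (g_hom _ _).1.
Qed.

Lemma range_closure_ract a : {homo ract C a : x / x \in range_closure}.
Proof.
apply: form_closure_stable; first exact: ract_bounded.
by move=> _ /asboolP[x ->]; apply/asboolP; exists (ract B a x); rewrite (g_hom _ _).2.
Qed.

Definition range_starBimodule : starBimodule A K :=
  pull_starBimodule (subspace_incl_hom range_closure_lact range_closure_ract).

(** The form of [H] is definite, so that the isometry [g] kills exactly the null
vectors and factors through the quotient. *)
Definition quot_lift (u : Q) : H := g (quot_repr u).

Lemma quot_liftE x : quot_lift (proj x) = g x.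
Proof.
apply/eqP; rewrite -subr_eq0 -linearB; apply/eqP/hilbertH.1.
by rewrite g_iso quot_repr_null.
Qed.

Lemma quot_lift_linear : linear quot_lift.
Proof.
move=> c u v; have [x ->] := form_quot_surj u; have [y ->] := form_quot_surj v.
by rewrite -linearP !quot_liftE linearP.
Qed.

HB.instance Definition _ :=
  GRing.isLinear.Build R[i] Q H *:%R quot_lift quot_lift_linear.

Lemma mem_quot_lift u : quot_lift u \in range_closure.
Proof. exact: mem_range_closure. Qed.

Definition range_completion : {linear Q -> K} := corestrict mem_quot_lift.

Lemma range_completionE x : incl (range_completion (proj x)) = g x.
Proof. exact: quot_liftE. Qed.

Lemma range_is_completion :
  is_completion (quot_starBimodule B) range_starBimodule range_completion.
Proof.
split.
- apply: subspace_hilbert hilbertH; exact: form_closure_closed.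
- move=> u v; have [x ->] := form_quot_surj u; have [y ->] := form_quot_surj v.
  by rewrite /= /pull_form !range_completionE g_iso quot_formE.
- move=> y e e0; have /asboolP/(_ e e0)[_ /asboolP[x ->] yx] := subspace_incl_mem y.
  exists (proj x); apply: le_lt_trans yx.
  by rewrite -range_completionE -linearB.
- move=> a u; have [x ->] := form_quot_surj u; split.
    apply: subspace_incl_inj; rewrite [lact _ _ _]quot_lactE range_completionE.
    by rewrite (g_hom _ _).1 (subspace_incl_hom _ _ _ _).1 range_completionE.
  apply: subspace_incl_inj; rewrite [ract _ _ _]quot_ractE range_completionE.
  by rewrite (g_hom _ _).2 (subspace_incl_hom _ _ _ _).2 range_completionE.
Qed.

End RangeCompletion.

(** * Nondegenerate right actions *)

(** Membership in a closed submodule can be tested after right multiplication. The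
difference [z] of [x] and its nearest point [p] in [S] is orthogonal to [S], and
z a is in [S], hence so is z a a*; thus <z a, z a> = <z, z a a*> = 0 for all a. *)
Lemma mem_closed_of_ract (R : realType) (A : starAlgType R) (H : lmodType R[i])
    (C : starBimodule A H) (S : submodClosed H) : is_hilbert (ip C) ->
  ract_nondegenerate C -> form_closed (ip C) S ->
  (forall a, {homo ract C a : x / x \in S}) ->
  forall x, (forall a, ract C a x \in S) -> x \in S.
Proof.
move=> [def complete] nondeg Scl rS x xS.
have [p pS pmin] := form_nearest_point complete Scl x.
suff /subr0_eq -> : x - p = 0 by [].
apply: nondeg => a; apply: def.
have zaS : ract C (astar a) (ract C a (x - p)) \in S.
  apply: (rS (astar a)); rewrite linearBr.
  exact: rpredD (xS a) (submodClosedN (rS a _ pS)).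
by rewrite form_real ip_ract (nearest_point_orthogonal pS pmin zaS).
Qed.

(** * The bimodule structure on the tensor product *)

Section TensorBimodule.
Variables (R : realType) (A : starAlgType R).
Local Notation T := (tensor A A).

HB.instance Definition _ := bilinear_isBilinear.Build R[i] A A A _ _ (@amul R A)
  (@amul_linearl R A, @amul_linearr R A).

Definition lact_pure (a b c : A) : T := tens (amul a b) c - tens a (amul b c).

Definition ract_pure (d b c : A) : T := tens b (amul c d).

Lemma lact_pure_linearl a c : linear (lact_pure a ^~ c).
Proof.
move=> k b b'; rewrite /lact_pure linearPr !linearPl linearPr scalerBr.
by rewrite opprD addrACA.
Qed.

Lemma lact_pure_linearr a b : linear (lact_pure a b).
Proof.
by move=> k c c'; rewrite /lact_pure !linearPr scalerBr opprD addrACA.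
Qed.

Lemma ract_pure_linearl d c : linear (ract_pure d ^~ c).
Proof. by move=> k b b'; rewrite /ract_pure linearPl. Qed.

Lemma ract_pure_linearr d b : linear (ract_pure d b).
Proof. by move=> k c c'; rewrite /ract_pure linearPl linearPr. Qed.

HB.instance Definition _ a := bilinear_isBilinear.Build R[i] A A T _ _
  (lact_pure a) (lact_pure_linearl a, lact_pure_linearr a).
HB.instance Definition _ d := bilinear_isBilinear.Build R[i] A A T _ _
  (ract_pure d) (ract_pure_linearl d, ract_pure_linearr d).

Definition tensor_lact (a : A) : T -> T := tensor_lift (lact_pure a).
Definition tensor_ract (d : A) : T -> T := tensor_lift (ract_pure d).

Lemma tensor_lactE a b c :
  tensor_lact a (tens b c) = tens (amul a b) c - tens a (amul b c).
Proof. exact: tensor_liftE. Qed.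

Lemma tensor_ractE d b c : tensor_ract d (tens b c) = tens b (amul c d).
Proof. exact: tensor_liftE. Qed.

Lemma tensor_lact_linearr a : linear (tensor_lact a).
Proof. exact: linearP. Qed.

Lemma tensor_ract_linearr d : linear (tensor_ract d).
Proof. exact: linearP. Qed.

HB.instance Definition _ a :=
  GRing.isLinear.Build R[i] T T *:%R (tensor_lact a) (tensor_lact_linearr a).
HB.instance Definition _ d :=
  GRing.isLinear.Build R[i] T T *:%R (tensor_ract d) (tensor_ract_linearr d).

Lemma tensor_lact_linearl t : linear (tensor_lact^~ t).
Proof.
move=> k a a'; pose g := k \*: tensor_lact a \+ tensor_lact a'.
apply: (@tensor_linear_ext _ _ _ _ (tensor_lact (k *: a + a')) g) => b c.
by rewrite /g /= !tensor_lactE !linearPl scalerBr opprD addrACA.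
Qed.

Lemma tensor_ract_linearl t : linear (tensor_ract^~ t).
Proof.
move=> k d d'; pose g := k \*: tensor_ract d \+ tensor_ract d'.
apply: (@tensor_linear_ext _ _ _ _ (tensor_ract (k *: d + d')) g) => b c.
by rewrite /g /= !tensor_ractE !linearPr.
Qed.

HB.instance Definition _ := bilinear_isBilinear.Build R[i] A T T _ _
  tensor_lact (tensor_lact_linearl, tensor_lact_linearr).
HB.instance Definition _ := bilinear_isBilinear.Build R[i] A T T _ _
  tensor_ract (tensor_ract_linearl, tensor_ract_linearr).

Lemma tensor_lactM a b t :
  tensor_lact (amul a b) t = tensor_lact a (tensor_lact b t).
Proof.
apply: (@tensor_linear_ext _ _ _ _ (tensor_lact (amul a b))
  (tensor_lact a \o tensor_lact b)) => c d /=.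
by rewrite !tensor_lactE linearBr /= !tensor_lactE !amulA opprB subrKA.
Qed.

Lemma tensor_ractM a b t :
  tensor_ract (amul a b) t = tensor_ract b (tensor_ract a t).
Proof.
apply: (@tensor_linear_ext _ _ _ _ (tensor_ract (amul a b))
  (tensor_ract b \o tensor_ract a)) => c d /=.
by rewrite !tensor_ractE amulA.
Qed.

Lemma tensor_lract_comm a b t :
  tensor_lact a (tensor_ract b t) = tensor_ract b (tensor_lact a t).
Proof.
apply: (@tensor_linear_ext _ _ _ _ (tensor_lact a \o tensor_ract b)
  (tensor_ract b \o tensor_lact a)) => c d /=.
by rewrite tensor_ractE !tensor_lactE linearBr /= !tensor_ractE amulA.
Qed.

Definition tensor_bimodule : bimodule A T :=
  @Bimodule _ _ _ tensor_lact tensor_ract tensor_lactM tensor_ractM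
    tensor_lract_comm.

End TensorBimodule.

(** * The homomorphism attached to a derivation *)

Section TensorOfDerivation.
Variables (R : realType) (A : starAlgType R) (H : lmodType R[i]).
Variables (C : bimodule A H) (delta : {linear A -> H}).
Hypothesis delta_derivation : is_derivation C delta.

Definition deriv_pure (a b : A) : H := ract C b (delta a).

Lemma deriv_pure_linearl b : linear (deriv_pure^~ b).
Proof. by move=> k a a'; rewrite /deriv_pure linearP linearPr. Qed.

Lemma deriv_pure_linearr a : linear (deriv_pure a).
Proof. by move=> k b b'; rewrite /deriv_pure linearPl. Qed.

HB.instance Definition _ := bilinear_isBilinear.Build R[i] A A H _ _
  deriv_pure (deriv_pure_linearl, deriv_pure_linearr).

Definition deriv_lift : {linear tensor A A -> H} := tensor_lift deriv_pure.

Lemma deriv_liftE a b : deriv_lift (tens a b) = ract C b (delta a).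
Proof. exact: tensor_liftE. Qed.

(** The Leibniz rule, solved for [a delta(b)]. It gives at once the compatibility
with the left action and the inclusion of the elements [a delta(b) c] in the
range. *)
Lemma lact_derivation a b c :
  ract C c (lact C a (delta b))
  = deriv_lift (tens (amul a b) c - tens a (amul b c)).
Proof.
by rewrite linearB !deriv_liftE delta_derivation linearDr /= ractM addrK.
Qed.

Lemma deriv_lift_hom : is_bimodule_hom (tensor_bimodule A) C deriv_lift.
Proof.
move=> a t; split.
  apply: (@tensor_linear_ext _ _ _ _ (deriv_lift \o lact (tensor_bimodule A) a)
    (lact C a \o deriv_lift)) => b c /=.
  by rewrite tensor_lactE -lact_derivation deriv_liftE lract_comm.
apply: (@tensor_linear_ext _ _ _ _ (deriv_lift \o ract (tensor_bimodule A) a)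
  (ract C a \o deriv_lift)) => b c /=.
by rewrite tensor_ractE !deriv_liftE ractM.
Qed.

End TensorOfDerivation.

Theorem theorem3p1 (R : realType) (A : starAlgType R) (H : lmodType R[i])
    (BH : starBimodule A H) (hilbertH : is_hilbert (ip BH))
    (nondegH : ract_nondegenerate BH)
    (delta : {linear A -> H}) (delta_derivation : is_derivation BH delta) :
  exists (BT : starBimodule A (tensor A A)) (phi : {linear tensor A A -> H}),
  [/\ forall a b c : A,
        lact BT a (tens b c) = tens (amul a b) c - tens a (amul b c),
      forall b c d : A, ract BT d (tens b c) = tens b (amul c d),
      is_isometric BT BH phi,
      is_bimodule_hom BT BH phi &
      exists (K : lmodType R[i]) (BK : starBimodule A K)
          (j : {linear form_quot (ip BT) -> K}),
        is_completion (quot_starBimodule BT) BK j /\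
        exists (phibar : {linear K -> H}) (partial : {linear A -> K}),
        [/\ [/\ forall t : tensor A A,
                  phibar (j (form_quot_proj (ip BT) t)) = phi t,
                is_isometric BK BH phibar &
                is_bimodule_hom BK BH phibar],
            is_derivation BK partial,
            forall a : A, delta a = phibar (partial a),
            forall a b c : A, exists t : tensor A A,
              ract BH c (lact BH a (delta b)) = phi t &
            forall e : A, (forall a : A, amul e a = a /\ amul a e = a) ->
              forall a : A,
                partial a = j (form_quot_proj (ip BT) (tens a e))]].
Proof.
pose phi := deriv_lift BH delta.
pose BT := pull_starBimodule (deriv_lift_hom delta_derivation).
have phi_hom : is_bimodule_hom BT BH phi by exact: deriv_lift_hom.
have phi_iso : is_isometric BT BH phi by [].
have delta_closure a : delta a \in range_closure BH phi.
  apply: mem_closed_of_ract hilbertH nondegH _ _ _ _.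
  - exact: form_closure_closed.
  - exact: range_closure_ract phi_hom.
  - by move=> b; rewrite -deriv_liftE; exact: mem_range_closure.
pose BK := range_starBimodule phi_hom.
pose phibar := subspace_incl (range_closure BH phi).
pose j := range_completion phi_iso hilbertH.
have jE t : phibar (j (form_quot_proj (ip BT) t)) = phi t.
  exact: range_completionE.
exists BT, phi; split=> //.
- by move=> a b c; exact: tensor_lactE.
- by move=> b c d; exact: tensor_ractE.
exists (subspace (range_closure BH phi)), BK, j; split.
  exact: range_is_completion.
exists phibar, (corestrict delta_closure); split=> //.
- move=> a b; apply: subspace_incl_inj; rewrite linearD.
  exact: delta_derivation.
- move=> a b c; exists (tens (amul a b) c - tens a (amul b c)).
  exact: lact_derivation.
move=> e eP a; apply: subspace_incl_inj; rewrite [RHS]jE deriv_liftE.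
(* [e] is not assumed to act as the identity on [H] *)
have /eqP : delta a - ract BH e (delta a) = 0.
  apply: nondegH => b.
  by rewrite linearBr -ractM (eP b).1 subrr.
by rewrite subr_eq0 => /eqP.
Qed.
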